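(* Let $\mathcal I=(i_-,i_+)\subseteq\mathbb R$ and let $P,Q$ be smooth functions on $\mathcal I$ with $P\ge 0$. Assume $Q$ is strictly increasing on $\mathcal I$ with $Q'(x)>0$ for all $x\in\mathcal I$, and $$\lim_{x\to i_-}Q(x)<0,\qquad \lim_{x\to i_+}Q(x)>0 .$$ Let $f_\infty$ be a probability density on $\mathcal I$ satisfying $$\frac{d}{dx}\big(P(x)f_\infty(x)\big)+Q(x)f_\infty(x)=0,\qquad x\in\mathcal I,$$ and let $X$ be a random variable with density $f_\infty$. Define $w(x)=P(x)/Q'(x)$ for $x\in\mathcal I$. Then for every smooth function $\phi$ on $\mathcal I$ such that $\phi(X)$ has finite variance, $$\int_{\mathcal I}\phi^2 f_\infty\,dx-\Big(\int_{\mathcal I}\phi f_\infty\,dx\Big)^2\le \int_{\mathcal I} w(x)\,(\phi'(x))^2 f_\infty(x)\,dx,$$ i.e. $\mathrm{Var}[\phi(X)]\le E\{w(X)[\phi'(X)]^2\}$ (meaning: whenever the right-hand side is finite, the inequality holds).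
   Context: $\mathrm{Var}[\phi(X)]=E[\phi(X)^2]-(E[\phi(X)])^2$. The differential relation for $f_\infty$ expresses that $f_\infty$ is a stationary solution of the Fokker–Planck equation $\partial_t f=\partial_x^2(Pf)+\partial_x(Qf)$ on $\mathcal I$. *)

(* Defs.v *)
From HB Require Import structures.
From mathcomp Require Import all_boot all_order all_algebra.
From mathcomp Require Import all_classical all_reals all_analysis.
Set Implicit Arguments. Unset Strict Implicit. Unset Printing Implicit Defensive.
Import Order.TTheory GRing.Theory Num.Theory.
Import numFieldNormedType.Exports.
Local Open Scope classical_set_scope.
Local Open Scope ring_scope.

Definition open_itv (R : realType) (a b : \bar R) : set R :=
  [set x : R | (a < x%:E)%E /\ (x%:E < b)%E].

Definition lower_end (R : realType) (a : \bar R) : set_system R :=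
  match a with EFin r => r^'+ | _ => ninfty_nbhs R end.

Definition upper_end (R : realType) (b : \bar R) : set_system R :=
  match b with EFin r => r^'- | _ => pinfty_nbhs R end.

Definition smooth_on (R : realType) (I : set R) (f : R -> R) : Prop :=
  forall (n : nat) (x : R), I x -> derivable (derive1n n f) x 1.

(* Main.v *)
Require Import Defs.
From HB Require Import structures.
From mathcomp Require Import all_boot all_order all_algebra.
From mathcomp Require Import all_classical all_reals all_analysis.
From mathcomp Require Import measurable_realfun ring lra.
Import Order.TTheory GRing.Theory Num.Theory.
Import numFieldNormedType.Exports.
Local Open Scope classical_set_scope.
Local Open Scope ring_scope.

(** Let [m] be the zero of [Q], [psi = phi - phi m], [g = P f], so that
    [g' = - Q f], and let [r = psi / Q], which extends continuously to [m].
    Then [(psi r)' = 2 r phi' - r^2 Q' <= phi'^2 / Q'], whence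
    [(g psi r)' = g (psi r)' - psi^2 f <= w phi'^2 f - psi^2 f].
    Since [g psi r = g r^2 Q] is [<= 0] to the left of [m] and [>= 0] to its
    right, integrating over [[al, be]] around [m] gives
    [int psi^2 f <= int w phi'^2 f], and the variance is at most [E psi(X)^2].
    The density is not assumed continuous, so the fundamental theorem of
    calculus is only applied inside [{g > 0}], where [f = g / P]; this set is an
    interval because [g] increases up to [m] and decreases afterwards, and [f]
    vanishes outside of it. *)

(** * Exhaustion of an open interval by compact intervals around a point *)

(** The end points are running minima and maxima of an enumeration of the rationals of [S], started
    at [m]. Since [S] is open, each of its points lies between two such rationals and is eventually
    enclosed. Bounded and unbounded [S] are treated alike. *)
Lemma open_interval_exhaustion {R : realType} (S : set R) (m : R) :
  open S -> is_interval S -> S m ->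
  exists al be : nat -> R,
    [/\ forall n, S (al n) /\ S (be n), forall n, al n <= m <= be n,
        {homo al : i j / (i <= j)%N >-> (j <= i)},
        {homo be : i j / (i <= j)%N >-> (i <= j)} &
        S = \bigcup_n `[al n, be n]%classic].
Proof.
move=> oS iS Sm.
(* Codes of no rational, and rationals outside [S], default to [m], so that every value of [e] lies
   in [S]. *)
pose e (n : nat) : R :=
  if unpickle n is Some q then if `[< S (ratr q) >] then ratr q else m else m.
have eS n : S (e n).
  by rewrite /e; case: unpickle => // q; case: ifPn => // /asboolP.
pose al := fix al n := if n is n'.+1 then Num.min (al n') (e n') else m.
pose be := fix be n := if n is n'.+1 then Num.max (be n') (e n') else m.
have alS n : al n.+1 = Num.min (al n) (e n) by [].
have beS n : be n.+1 = Num.max (be n) (e n) by [].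
have alD : {homo al : i j / (i <= j)%N >-> (j <= i)}.
  move=> i j /subnKC <-; elim: (j - i)%N => [|k IH]; first by rewrite addn0.
  by rewrite addnS alS ge_min IH.
have beD : {homo be : i j / (i <= j)%N >-> (i <= j)}.
  move=> i j /subnKC <-; elim: (j - i)%N => [|k IH]; first by rewrite addn0.
  by rewrite addnS beS le_max IH.
have abS n : S (al n) /\ S (be n).
  elim: n => [//|n [IHa IHb]]; rewrite alS beS; split.
    by rewrite minElt; case: ifP.
  by rewrite maxElt; case: ifP.
have abm n : al n <= m <= be n by rewrite (alD 0%N n) ?(beD 0%N n).
exists al, be; split => //; apply/seteqP; split => [x Sx|x [n _]]; last first.
  by rewrite /= in_itv/=; case: (abS n) => Sa Sb; exact: iS Sa Sb _.
have [d d0 dS] : exists2 d, 0 < d & ball x d `<=` S.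
  by have /nbhs_ballP[d d0 dS] := open_nbhs_nbhs (conj oS Sx); exists d.
have q1 : x - d < x by lra.
have q2 : x < x + d by lra.
have [p pP] := rat_in_itvoo q1; have [q qP] := rat_in_itvoo q2.
move: pP qP; rewrite !in_itv/= => /andP[p1 p2] /andP[q3 q4].
have eE (s : rat) : S (ratr s) -> e (pickle s) = ratr s.
  by move=> Ss; rewrite /e pickleK; case: ifPn => // /asboolP.
have Sp : S (ratr p).
  by apply: dS; rewrite /ball/= ltr_norml; apply/andP; split; lra.
have Sq : S (ratr q).
  by apply: dS; rewrite /ball/= ltr_norml; apply/andP; split; lra.
(* The value [e n] enters the running minimum and maximum only at index [n.+1]. *)
exists (maxn (pickle p).+1 (pickle q).+1) => //=; rewrite in_itv/=.
apply/andP; split.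
  apply: (le_trans (alD _ _ (leq_maxl _ _))).
  by rewrite alS ge_min (eE p)// (ltW p2) orbT.
apply: (le_trans _ (beD _ _ (leq_maxr _ _))).
by rewrite beS le_max (eE q)// (ltW q3) orbT.
Qed.

(** By monotone convergence the integral of [h] over [S] is the limit of its integrals over the
    exhausting intervals. Each of these is bounded by the integral of [k] over the same interval,
    hence over [S], as [k] is nonnegative. The comparison is asked only on intervals containing [m],
    where the boundary terms have a known sign. *)
Lemma le_integral_open_interval {R : realType} (S : set R) (m : R)
    (h k : R -> R) :
  open S -> is_interval S -> S m ->
  measurable_fun S h -> measurable_fun S k ->
  (forall x, S x -> 0 <= h x) -> (forall x, S x -> 0 <= k x) ->
  (forall x y, S x -> S y -> x <= m <= y ->
    (\int[lebesgue_measure]_(t in `[x, y]) (h t)%:E <=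
     \int[lebesgue_measure]_(t in `[x, y]) (k t)%:E)%E) ->
  (\int[lebesgue_measure]_(t in S) (h t)%:E <=
   \int[lebesgue_measure]_(t in S) (k t)%:E)%E.
Proof.
move=> oS iS Sm mh mk h0 k0 hk.
have [al [be [abS abm alD beD SE]]] := open_interval_exhaustion S m oS iS Sm.
have sub n : `[al n, be n]%classic `<=` S.
  by move=> x; rewrite /= in_itv/=; case: (abS n) => Sa Sb; exact: iS Sa Sb _.
have mS : measurable S by exact: open_measurable.
have cvS (u : R -> R) : measurable_fun S u -> (forall x, S x -> 0 <= u x) ->
    (\int[lebesgue_measure]_(t in `[al n, be n]) (u t)%:E)%E @[n --> \oo] -->
    (\int[lebesgue_measure]_(t in S) (u t)%:E)%E.
  move=> mu u0; rewrite [in X in _ --> X]SE.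
  apply: (@ge0_nondecreasing_set_cvg_integral _ (measurableTypeR R) R
    (fun n => `[al n, be n]%classic) (EFin \o u) lebesgue_measure).
  - move=> i j ij; apply/subsetPset => x; rewrite /= !in_itv/= => /andP[xa xb].
    by rewrite (le_trans (alD _ _ ij) xa) (le_trans xb (beD _ _ ij)).
  - by move=> i; exact: measurable_itv.
  - by move=> i; apply/measurable_EFinP; apply: measurable_funS mu.
  - by move=> i x /sub /u0; rewrite lee_fin.
rewrite -(cvg_lim _ (cvS h mh h0))//.
apply: lime_le; first by apply/cvg_ex; eexists; exact: cvS h mh h0.
apply: nearW => n.
have [Sa Sb] := abS n; apply: le_trans (hk _ _ Sa Sb (abm n)) _.
apply: ge0_subset_integral => //; exact/measurable_EFinP.
Qed.

(** * The chord quotient and its derivative *)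

(* [r] is the quotient [(phi - phi m) / Q], continuously extended at [m]. *)
Lemma derive_chord_quotient {R : realType} (I : set R) (m : R) (phi Q : R -> R) :
  open I -> I m -> Q m = 0 -> derive1 Q m != 0 ->
  (forall x, I x -> x != m -> Q x != 0) ->
  (forall x, I x -> derivable phi x 1) -> (forall x, I x -> derivable Q x 1) ->
  exists r : R -> R,
    forall x, I x ->
      [/\ phi x - phi m = r x * Q x, {for x, continuous r} &
        is_derive x 1 (fun z => (phi z - phi m) * r z)
          (2 * r x * derive1 phi x - r x ^+ 2 * derive1 Q x)].
Proof.
move=> oI Im Qm Qm' Q0 dphi dQ.
have isd (h : R -> R) x : derivable h x 1 -> is_derive x 1 h (derive1 h x).
  by move=> dh; rewrite derive1E; exact: derivableP.
(* Carathéodory slopes at [m]: [phi z - phi m = k z * (z - m)] and [Q z = q z * (z - m)], with [k]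
   and [q] continuous at [m]. Thus [k / q] is the wanted quotient away from [m], and equals
   [phi' / Q'] at [m]. *)
have [k [kE kc km]] := (is_derive1_caratheodory _ _ _).1 (isd _ _ (dphi m Im)).
have [q [qE qc qm]] := (is_derive1_caratheodory _ _ _).1 (isd _ _ (dQ m Im)).
have qE' z : Q z = q z * (z - m) by rewrite -qE Qm subr0.
pose r z := k z / q z.
have rE x : I x -> phi x - phi m = r x * Q x.
  move=> Ix; have [->|xm] := eqVneq x m; first by rewrite Qm mulr0 subrr.
  have qx : q x != 0.
    by apply: contra_neq (Q0 _ Ix xm) => qx; rewrite qE' qx mul0r.
  by rewrite kE qE' /r; field.
have Inbhs x : I x -> nbhs x I by move=> Ix; exact: open_nbhs_nbhs.
exists r => x Ix; split; first exact: rE.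
  have [->|xm] := eqVneq x m.
    by apply: cvgM => //; apply: cvgV => //; rewrite qm.
  have cr : {for x, continuous (fun z => (phi z - phi m) / Q z)}.
    apply: cvgM; last first.
      apply: cvgV; first exact: Q0.
      by apply: differentiable_continuous; apply/derivable1_diffP; exact: dQ.
    apply: cvgB; last exact: cvg_cst.
    by apply: differentiable_continuous; apply/derivable1_diffP; exact: dphi.
  have nE : \forall z \near x, (phi z - phi m) / Q z = r z.
    near=> z; have Iz : I z by near: z; exact: Inbhs.
    have zm : z != m by near: z; exact: open_nbhs_nbhs (conj (@open_neq R m) xm).
    by rewrite rE// mulfK// Q0.
  have rx := nbhs_singleton nE; rewrite /= in rx.
  change (r z @[z --> x] --> r x); rewrite -rx.
  by apply: cvg_trans cr; apply: near_eq_cvg.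
have [xm|xm] := eqVneq x m.
  (* Only continuity of [r] is known at [m], so the product is differentiated through its own slope
     [k r]. Its value [phi'^2 / Q'] at [m] is [2 r phi' - r^2 Q'] for [r = phi' / Q']. *)
  rewrite xm; apply/is_derive1_caratheodory; exists (fun z => k z * r z); split.
  - by move=> z; rewrite !subrr mul0r subr0 kE mulrAC.
  - by apply: cvgM => //; apply: cvgM => //; apply: cvgV => //; rewrite qm.
  - by rewrite /r km qm; field.
have Qx := Q0 _ Ix xm.
have dphix : is_derive x 1 phi (derive1 phi x) by exact/isd/dphi.
have dQx : is_derive x 1 Q (derive1 Q x) by exact/isd/dQ.
have dqx : is_derive x 1 (fun z => (Q z)^-1) (- (Q x) ^- 2 *: derive1 Q x).
  exact: is_deriveV.
(* Away from [m] the product is [(phi - phi m)^2 / Q], to which the usual rules apply. *)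
have du : is_derive x 1 (fun z => (phi z - phi m) * (phi z - phi m) * (Q z)^-1)
   (2 * r x * derive1 phi x - r x ^+ 2 * derive1 Q x).
  apply: is_derive_eq.
  have -> : r x = (phi x - phi m) / Q x by rewrite rE// mulfK.
  rewrite /GRing.scale/=; field. exact: Qx.
apply: near_eq_is_derive du.
near=> z; have Iz : I z by near: z; exact: Inbhs.
have zm : z != m by near: z; exact: open_nbhs_nbhs (conj (@open_neq R m) xm).
by rewrite [phi z - _]rE//; field; exact: Q0.
Unshelve. all: by end_near.
Qed.

(** * Variance and mean square deviation *)

(** Expanding the square, the right side exceeds the left by [(E phi - k)^2]. This allows centring
    at [phi m] instead of at the mean. *)
Lemma variance_le_mean_sqr {d : measure_display} {T : measurableType d}
    {R : realType} (mu : {measure set T -> \bar R}) (D : set T) (f phi : T -> R)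
    (k : R) :
  measurable D -> measurable_fun D f -> measurable_fun D phi ->
  (forall x, D x -> 0 <= f x) ->
  (\int[mu]_(x in D) (f x)%:E = 1)%E ->
  mu.-integrable D (fun x => (phi x ^+ 2 * f x)%:E) ->
  (\int[mu]_(x in D) (phi x ^+ 2 * f x)%:E
   - (\int[mu]_(x in D) (phi x * f x)%:E) * (\int[mu]_(x in D) (phi x * f x)%:E)
   <= \int[mu]_(x in D) ((phi x - k) ^+ 2 * f x)%:E)%E.
Proof.
move=> mD mf mphi f0 f1 i2.
have i0 : mu.-integrable D (fun x => (f x)%:E).
  apply/integrableP; split; first exact/measurable_EFinP.
  rewrite (eq_integral (fun x => (f x)%:E)) ?f1 ?ltry// => x /set_mem Dx /=.
  by rewrite ger0_norm// f0.
(* The first moment is finite because [|phi| <= 1 + phi^2]. *)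
have i1 : mu.-integrable D (fun x => (phi x * f x)%:E).
  apply: (le_integrable mD _ _ (integrableD mD i0 i2)) => /=.
    by apply/measurable_EFinP; exact: measurable_funM.
  move=> x Dx; rewrite lee_fin.
  have fx := f0 _ Dx.
  rewrite normrM (ger0_norm fx) [leRHS]ger0_norm; last first.
    by rewrite addr_ge0// mulr_ge0// sqr_ge0.
  rewrite -[X in _ <= X + _]mul1r -mulrDl ler_wpM2r// -(real_normK (num_real (phi x))).
  by have := sqr_ge0 (`|phi x| - 1); have := normr_ge0 (phi x); nra.
have E : (\int[mu]_(x in D) ((phi x - k) ^+ 2 * f x)%:E =
    \int[mu]_(x in D) (phi x ^+ 2 * f x)%:E
    + ((- (2 * k))%:E * \int[mu]_(x in D) (phi x * f x)%:E
       + (k ^+ 2)%:E * \int[mu]_(x in D) (f x)%:E))%E.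
  rewrite -integralZl// -[X in (_ + (_ + X))%E]integralZl// -integralD//=; last 2 first.
  - exact: integrableZl.
  - exact: integrableZl.
  rewrite -integralD//=; last first.
    by apply: integrableD => //; exact: integrableZl.
  by apply: eq_integral => x _; rewrite -!EFinM -!EFinD; congr EFin; ring.
rewrite E f1 mule1.
have /fineK <- := integrable_fin_num mD i2.
have /fineK <- := integrable_fin_num mD i1.
rewrite -!EFinM -EFinB -!EFinD lee_fin.
set A := fine _; set B := fine _.
by have := sqr_ge0 (B - k); nra.
Qed.

(** * The inequality on a compact interval *)

Lemma weighted_poincare_itv {R : realType} (al be m : R) (f g phi Q r : R -> R) :
  al < be ->
  (forall x, `[al, be]%classic x -> [/\ 0 < derive1 Q x, 0 <= g x &
     {for x, continuous f}]) ->
  (forall x, `[al, be]%classic x ->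
    [/\ {for x, continuous phi}, {for x, continuous (derive1 phi)} &
        {for x, continuous (derive1 Q)}]) ->
  (forall x, `[al, be]%classic x -> is_derive x 1 g (- (Q x * f x))) ->
  (forall x, `[al, be]%classic x ->
     [/\ phi x - phi m = r x * Q x, {for x, continuous r} &
        is_derive x 1 (fun z => (phi z - phi m) * r z)
          (2 * r x * derive1 phi x - r x ^+ 2 * derive1 Q x)]) ->
  Q al <= 0 <= Q be ->
  (\int[lebesgue_measure]_(x in `[al, be]) ((phi x - phi m) ^+ 2 * f x)%:E <=
   \int[lebesgue_measure]_(x in `[al, be])
      (g x * (derive1 phi x ^+ 2 / derive1 Q x))%:E)%E.
Proof.
move=> ab h1 h2 dg hr /andP[Qa Qb].
pose du x := 2 * r x * derive1 phi x - r x ^+ 2 * derive1 Q x.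
pose F x := g x * ((phi x - phi m) * r x).
pose dF x := g x * du x - (phi x - phi m) ^+ 2 * f x.
(* The product rule gives the term [g' (phi - phi m) r]; with [g' = - Q f] and [r Q = phi - phi m]
   it becomes [- (phi - phi m)^2 f]. *)
have dFE x : `[al, be]%classic x -> is_derive x 1 F (dF x).
  move=> xab; have dgx := dg _ xab; have [rE _ dux] := hr _ xab.
  apply: is_derive_eq; rewrite /dF /du rE /GRing.scale/=; ring.
have cg x : `[al, be]%classic x -> {for x, continuous g}.
  move=> xab; apply: differentiable_continuous; apply/derivable1_diffP.
  by have [] := dg _ xab.
have cF x : `[al, be]%classic x -> {for x, continuous F}.
  move=> xab; apply: differentiable_continuous; apply/derivable1_diffP.
  by have [] := dFE _ xab.
have cw (h : R -> R) : (forall x, `[al, be]%classic x -> {for x, continuous h}) ->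
    {within `[al, be], continuous h}.
  by move=> hc; apply: continuous_in_subspaceT => x /set_mem; exact: hc.
have cpsi x : `[al, be]%classic x ->
    {for x, continuous (fun x => (phi x - phi m) ^+ 2 * f x)}.
  move=> xab; have [? _ _] := h2 _ xab; have [_ _ ?] := h1 _ xab.
  apply: cvgM => //; under eq_cvg do rewrite expr2; rewrite expr2.
  by apply: cvgM; apply: cvgB => //; exact: cvg_cst.
have cdu x : `[al, be]%classic x -> {for x, continuous du}.
  move=> xab; have [_ ? ?] := h2 _ xab; have [_ ? _] := hr _ xab.
  apply: cvgB; first by apply: cvgM => //; apply: cvgM => //; exact: cvg_cst.
  apply: cvgM => //; under eq_cvg do rewrite expr2; rewrite expr2.
  exact: cvgM.
have cdF x : `[al, be]%classic x -> {for x, continuous dF}.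
  by move=> xab; apply: cvgB; [apply: cvgM; [exact: cg|exact: cdu]|exact: cpsi].
have cw2 x : `[al, be]%classic x ->
    {for x, continuous (fun x => g x * (derive1 phi x ^+ 2 / derive1 Q x))}.
  move=> xab; have [_ ? ?] := h2 _ xab; have [Q0 _ _] := h1 _ xab.
  apply: cvgM; first exact: cg.
  apply: cvgM; last by apply: cvgV => //; exact: lt0r_neq0.
  by under eq_cvg do rewrite expr2; rewrite expr2; exact: cvgM.
have int (h : R -> R) : (forall x, `[al, be]%classic x -> {for x, continuous h}) ->
    lebesgue_measure.-integrable `[al, be] (fun x => (h x)%:E).
  move=> hc; apply: continuous_compact_integrable; first exact: segment_compact.
  exact: cw.
have alab : `[al, be]%classic al by rewrite /= in_itv/= lexx ltW.
have beab : `[al, be]%classic be by rewrite /= in_itv/= lexx ltW.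
have FTC : (\int[lebesgue_measure]_(x in `[al, be]) (dF x)%:E =
    (F be)%:E - (F al)%:E)%E.
  apply: continuous_FTC2 => //; first exact: cw.
    split; last 2 first.
    - by apply: cvg_at_right_filter; exact: cF.
    - by apply: cvg_at_left_filter; exact: cF.
    by move=> x /subset_itv_oo_cc xab; have [] := dFE _ xab.
  move=> x /subset_itv_oo_cc xab; rewrite derive1E.
  by have dFx := dFE _ xab; exact: derive_val.
have sgn x : `[al, be]%classic x -> F x = g x * r x ^+ 2 * Q x.
  by move=> xab; have [rE _ _] := hr _ xab; rewrite /F rE; ring.
(* [F = g r^2 Q] has the sign of [Q] or vanishes, so [F al <= 0 <= F be]. *)
have F0 : 0 <= F be - F al.
  have [_ ga _] := h1 _ alab; have [_ gb _] := h1 _ beab.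
  rewrite subr_ge0 !sgn// (@le_trans _ _ 0)//.
    by rewrite mulr_ge0_le0// mulr_ge0// sqr_ge0.
  by rewrite mulr_ge0// mulr_ge0// sqr_ge0.
(* Adding the nonnegative increment of [F], written as the integral of [dF], cancels the left
   integrand and leaves [g * du]. *)
apply: (@le_trans _ _ (\int[lebesgue_measure]_(x in `[al, be])
    ((phi x - phi m) ^+ 2 * f x)%:E
   + \int[lebesgue_measure]_(x in `[al, be]) (dF x)%:E)%E).
  by rewrite leeDl// FTC -EFinB lee_fin.
rewrite -integralD//=; [|exact: int cpsi|exact: int cdF].
apply: le_integral => //; [by apply: integrableD => //; exact: int|exact: int|].
move=> x /set_mem xab; have [Q0 g0 _] := h1 _ xab.
rewrite -EFinD lee_fin /dF addrCA subrr addr0 ler_wpM2l// /du.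
rewrite -subr_ge0.
(* Completing the square in [r]: the gap between [phi'^2 / Q'] and [du] is a square over
   [Q' > 0]. *)
have -> : derive1 phi x ^+ 2 / derive1 Q x -
   (2 * r x * derive1 phi x - r x ^+ 2 * derive1 Q x) =
   (derive1 phi x - r x * derive1 Q x) ^+ 2 / derive1 Q x.
  by field; exact: lt0r_neq0.
by rewrite divr_ge0// ?sqr_ge0// ltW.
Qed.

(** * Intervals with extended end points and the zero of the drift *)

Lemma open_open_itv {R : realType} (a b : \bar R) : open (open_itv a b).
Proof. by apply: openI; [exact: open_ereal_gt|exact: open_ereal_lt]. Qed.

Lemma is_interval_open_itv {R : realType} (a b : \bar R) :
  is_interval (open_itv a b).
Proof.
move=> x y [ax _] [_ yb] z /andP[xz zy]; split.
  by apply: lt_le_trans ax _; rewrite lee_fin.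
by apply: le_lt_trans yb; rewrite lee_fin.
Qed.

Lemma near_lower_end {R : realType} (a b : \bar R) :
  (a < b)%E -> \forall x \near lower_end a, open_itv a b x.
Proof.
(* The condition [a < b] discards [a = +oo], where [lower_end] would fall back on the neighbourhoods
   of [-oo]. *)
case: a => [r| |]; case: b => [s| |] //= ab.
- near=> x; split; rewrite lte_fin; near: x; first exact: nbhs_right_gt.
  by apply: nbhs_right_lt; rewrite -lte_fin.
- near=> x; split; last exact: ltry.
  by rewrite lte_fin; near: x; exact: nbhs_right_gt.
- by near=> x; split; [exact: ltNyr|rewrite lte_fin; near: x; exact: nbhs_ninfty_lt].
- by near=> x; split; [exact: ltNyr|exact: ltry].
Unshelve. all: by end_near.
Qed.

Lemma near_upper_end {R : realType} (a b : \bar R) :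
  (a < b)%E -> \forall x \near upper_end b, open_itv a b x.
Proof.
case: b => [s| |]; case: a => [r| |] //= ab.
- near=> x; split; rewrite lte_fin; near: x; last exact: nbhs_left_lt.
  by apply: nbhs_left_gt; rewrite -lte_fin.
- near=> x; split; first exact: ltNyr.
  by rewrite lte_fin; near: x; exact: nbhs_left_lt.
- by near=> x; split; [rewrite lte_fin; near: x; exact: nbhs_pinfty_gt|exact: ltry].
- by near=> x; split; [exact: ltNyr|exact: ltry].
Unshelve. all: by end_near.
Qed.

Lemma lower_end_proper {R : realType} (a : \bar R) : ProperFilter (lower_end a).
Proof. by case: a => [r| |] /=; apply: _. Qed.

Lemma upper_end_proper {R : realType} (b : \bar R) : ProperFilter (upper_end b).
Proof. by case: b => [r| |] /=; apply: _. Qed.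

(** The limits, possibly infinite, have strict signs, so [Q] is negative somewhere and positive
    elsewhere; the intermediate value theorem applies between two such points. *)
Lemma exists_zero_open_itv {R : realType} (a b : \bar R) (Q : R -> R) :
  (a < b)%E ->
  (forall x, open_itv a b x -> {for x, continuous Q}) ->
  {in open_itv a b &, {homo Q : x y / x < y}} ->
  (exists2 l : \bar R, (l < 0)%E & (Q x)%:E @[x --> lower_end a] --> l) ->
  (exists2 l : \bar R, (0 < l)%E & (Q x)%:E @[x --> upper_end b] --> l) ->
  exists2 m, open_itv a b m & Q m = 0.
Proof.
move=> ab cQ Qinc [l l0 Ql] [k k0 Qk].
have pa := lower_end_proper a; have pb := upper_end_proper b.
have [x [Ix Qx]] : exists x, open_itv a b x /\ Q x < 0.
  apply: (@filter_ex _ (lower_end a)); apply: filterI; first exact: near_lower_end.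
  have Ql0 : \forall x \near lower_end a, ((Q x)%:E < 0)%E := Ql _ (open_ereal_lt' l0).
  by apply: filterS Ql0 => x; rewrite lte_fin.
have [y [Iy Qy]] : exists x, open_itv a b x /\ 0 < Q x.
  apply: (@filter_ex _ (upper_end b)); apply: filterI; first exact: near_upper_end.
  have Qk0 : \forall x \near upper_end b, (0 < (Q x)%:E)%E := Qk _ (open_ereal_gt' k0).
  by apply: filterS Qk0 => z; rewrite lte_fin.
have xy : x <= y.
  rewrite leNgt; apply/negP => yx.
  by have := Qinc _ _ (mem_set Iy) (mem_set Ix) yx; lra.
have sub : `[x, y]%classic `<=` open_itv a b.
  by move=> z /=; rewrite in_itv/=; exact: is_interval_open_itv.
have [||m mxy Qm] := @IVT _ Q x y 0 xy.
- by apply: continuous_in_subspaceT => z /set_mem /sub; exact: cQ.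
- by rewrite ge_min le_max (ltW Qx) (ltW Qy) orbT.
- by exists m => //; exact: sub.
Qed.

(** * The variance inequality *)

Theorem theorem2p1 (R : realType) (a b : \bar R) (P Q f : R -> R)
  (hab : (a < b)%E)
  (hP : smooth_on (open_itv a b) P)
  (hQ : smooth_on (open_itv a b) Q)
  (hP0 : forall x, open_itv a b x -> 0 <= P x)
  (hQinc : {in open_itv a b &, {homo Q : x y / x < y}})
  (hQ' : forall x, open_itv a b x -> 0 < derive1 Q x)
  (hQlo : exists2 l : \bar R, (l < 0)%E & (Q x)%:E @[x --> lower_end a] --> l)
  (hQhi : exists2 l : \bar R, (0 < l)%E & (Q x)%:E @[x --> upper_end b] --> l)
  (hfm : measurable_fun (open_itv a b) f)
  (hf0 : forall x, open_itv a b x -> 0 <= f x)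
  (hf1 : (\int[lebesgue_measure]_(x in open_itv a b) (f x)%:E = 1)%E)
  (hfeq : forall x, open_itv a b x ->
     derivable (P \* f) x 1 /\ derive1 (P \* f) x + Q x * f x = 0)
  (phi : R -> R)
  (hphi : smooth_on (open_itv a b) phi)
  (hvar : lebesgue_measure.-integrable (open_itv a b)
            (fun x => (phi x ^+ 2 * f x)%:E))
  (hrhs : (\int[lebesgue_measure]_(x in open_itv a b)
            ((P x / derive1 Q x) * (derive1 phi x) ^+ 2 * f x)%:E < +oo)%E) :
  (\int[lebesgue_measure]_(x in open_itv a b) (phi x ^+ 2 * f x)%:E
   - (\int[lebesgue_measure]_(x in open_itv a b) (phi x * f x)%:E)
     * (\int[lebesgue_measure]_(x in open_itv a b) (phi x * f x)%:E)
   <= \int[lebesgue_measure]_(x in open_itv a b)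
        ((P x / derive1 Q x) * (derive1 phi x) ^+ 2 * f x)%:E)%E.
Proof.
pose I := open_itv a b; pose g := P \* f.
have oI : open I by exact: open_open_itv.
have iI : is_interval I by exact: is_interval_open_itv.
have mI : measurable I by exact: open_measurable.
have dcont (h : R -> R) x : derivable h x 1 -> {for x, continuous h}.
  by move=> dh; apply: differentiable_continuous; exact/derivable1_diffP.
have mcont (h : R -> R) : (forall x, I x -> {for x, continuous h}) ->
    measurable_fun I h.
  by move=> hc; apply: open_continuous_measurable_fun => // x /set_mem; exact: hc.
have cP x : I x -> {for x, continuous P} by move=> Ix; exact/dcont/(hP 0%N).
have cQ x : I x -> {for x, continuous Q} by move=> Ix; exact/dcont/(hQ 0%N).
have cQ' x : I x -> {for x, continuous (derive1 Q)}.
  by move=> Ix; exact/dcont/(hQ 1%N).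
have cphi x : I x -> {for x, continuous phi} by move=> Ix; exact/dcont/(hphi 0%N).
have cphi' x : I x -> {for x, continuous (derive1 phi)}.
  by move=> Ix; exact/dcont/(hphi 1%N).
have dg x : I x -> is_derive x 1 g (- (Q x * f x)).
  move=> /hfeq[dgx /eqP]; rewrite addr_eq0 => /eqP <-.
  by rewrite derive1E; exact: derivableP.
have g'E x : I x -> derive1 g x = - (Q x * f x).
  by move=> Ix; rewrite derive1E; have dgx := dg _ Ix; exact: derive_val.
have dg' x : I x -> derivable g x 1 by case/hfeq.
have cg x : I x -> {for x, continuous g} by move=> Ix; exact/dcont/dg'.
have g0 x : I x -> 0 <= g x by move=> Ix; rewrite mulr_ge0 ?hP0 ?hf0.
have [m Im Qm] := exists_zero_open_itv a b Q hab cQ hQinc hQlo hQhi.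
have Qpos x : I x -> m < x -> 0 < Q x.
  by move=> Ix mx; rewrite -Qm hQinc// mem_set.
have Qneg x : I x -> x < m -> Q x < 0.
  by move=> Ix mx; rewrite -Qm hQinc// mem_set.
have Q0 x : I x -> x != m -> Q x != 0.
  move=> Ix; rewrite neq_lt => /orP[xm|xm]; first by rewrite lt_eqF// Qneg.
  by rewrite gt_eqF// Qpos.
have sub x y : I x -> I y -> `[x, y]%classic `<=` I.
  by move=> Ix Iy z /=; rewrite in_itv/=; exact: iI.
have cwg x y : I x -> I y -> {within `[x, y], continuous g}.
  move=> Ix Iy; apply: continuous_in_subspaceT => z /set_mem zxy.
  exact/cg/(sub x y).
have gup x y : I x -> x <= y <= m -> g x <= g y.
  move=> Ix /andP[xy ym].
  have xm := le_trans xy ym.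
  have I' z : z \in `]x, m[ -> I z by move=> /subset_itv_oo_cc; exact: sub.
  apply: (@ger0_derive1_le_cc _ g x m) => //.
  - by move=> z /I' /dg'.
  - move=> z zxm; have Iz := I' _ zxm; rewrite g'E// oppr_ge0.
    rewrite mulr_le0_ge0 ?hf0//; apply/ltW/Qneg => //.
    by move: zxm; rewrite in_itv/= => /andP[].
  - exact: cwg.
  - by rewrite in_itv/= lexx.
  - by rewrite in_itv/= xy.
have gdown x y : I y -> m <= x <= y -> g y <= g x.
  move=> Iy /andP[mx xy].
  have my := le_trans mx xy.
  have I' z : z \in `]m, y[ -> I z by move=> /subset_itv_oo_cc; exact: sub.
  apply: (@ler0_derive1_le_cc _ g m y) => //.
  - by move=> z /I' /dg'.
  - move=> z zmy; have Iz := I' _ zmy; rewrite g'E// oppr_le0.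
    rewrite mulr_ge0 ?hf0//; apply/ltW/Qpos => //.
    by move: zmy; rewrite in_itv/= => /andP[].
  - exact: cwg.
  - by rewrite in_itv/= lexx my.
  - by rewrite in_itv/= mx.
pose S := [set x | I x /\ 0 < g x].
have SI : S `<=` I by move=> x [].
(* [g >= 0] is minimal, hence stationary, wherever it vanishes. *)
have f_eq0 x : I x -> x != m -> ~ S x -> f x = 0.
  move=> Ix xm nSx.
  have gx : g x = 0.
    by apply/eqP; rewrite eq_le g0// andbT leNgt; apply/negP => gx; apply: nSx.
  have /nbhs_ballP[e e0 eI] := open_nbhs_nbhs (conj oI Ix).
  have eI' t : t \in `]x - e, x + e[ -> I t.
    rewrite in_itv/= => /andP[t1 t2]; apply: eI.
    by rewrite /ball/= ltr_norml; apply/andP; split; lra.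
  have /= e0' : 0 < e by [].
  have [||||_ gd] := @derive1_at_min _ g (x - e) (x + e) x.
  - by lra.
  - by move=> t /eI' /dg'.
  - by rewrite in_itv/=; apply/andP; split; lra.
  - by move=> t /eI' It; rewrite gx g0.
  have := g'E _ Ix; rewrite derive1E gd => /esym/eqP.
  by rewrite oppr_eq0 mulf_eq0 (negbTE (Q0 _ Ix xm)) => /eqP.
(* As [m] maximizes [g], [g m = 0] would force [g = 0] on [I]. Then [f = 0] off the null set
   [[set m]], against total mass 1. *)
have Sm : S m.
  split => //; rewrite lt_neqAle g0// andbT eq_sym; apply/eqP => gm.
  have nS x : ~ S x.
    case=> Ix gx; suff : g x <= g m by rewrite gm leNgt gx.
    by have [xm|/ltW mx] := leP x m; [rewrite gup ?xm ?lexx|rewrite gdown ?mx ?lexx].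
  move: hf1; rewrite (@ae_eq_integral _ _ _ _ _ (cst 0%E))//.
  - by rewrite integral0 => /eqP; rewrite eq_sym onee_eq0.
  - exact/measurable_EFinP.
  - exists [set m]; split => //; first exact: lebesgue_measure_set1.
    move=> x /= /not_implyP[Ix fx]; apply/eqP; apply: contra_notT fx => xm.
    by rewrite (f_eq0 x).
have oS : open S.
  rewrite openE => x [Ix gx]; apply: filterI; first exact: open_nbhs_nbhs.
  exact: (cg _ Ix) _ (lt_nbhsr gx).
(* A point [z] between [x] and [y] lies between [m] and one of them, and there monotonicity bounds
   [g z] below by the positive value of [g] at that end point. *)
have iS : is_interval S.
  move=> x y [Ix gx] [Iy gy] z /andP[xz zy].
  have Iz : I z by apply: (iI x y) => //; rewrite xz.
  split => //; have [zm|/ltW mz] := leP z m.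
    by apply: lt_le_trans gx _; rewrite gup ?xz.
  by apply: lt_le_trans gy _; rewrite gdown ?mz.
have mS : measurable S by exact: open_measurable.
(* Positivity of [g = P f] forces [P > 0], near [x] as well, so [f] coincides there with [g / P]. *)
have fc x : S x -> {for x, continuous f}.
  move=> [Ix gx].
  have Px : 0 < P x.
    rewrite lt_neqAle hP0// andbT eq_sym; apply/eqP => Px.
    by move: gx; rewrite /g/= Px mul0r ltxx.
  have c : {for x, continuous (fun z => g z / P z)}.
    by apply: cvgM; [exact: cg|apply: cvgV; [exact: lt0r_neq0|exact: cP]].
  have nE : \forall z \near x, g z / P z = f z.
    near=> z; have Pz : 0 < P z by near: z; exact: (cP _ Ix) _ (lt_nbhsr Px).
    by rewrite /g/= mulrAC mulfV ?mul1r// lt0r_neq0.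
  have fx := nbhs_singleton nE; rewrite /= in fx.
  change (f z @[z --> x] --> f x); rewrite -fx.
  by apply: cvg_trans c; apply: near_eq_cvg.
have [r hr] := derive_chord_quotient I m phi Q oI Im Qm (lt0r_neq0 (hQ' _ Im)) Q0
  (hphi 0%N) (hQ 0%N).
apply: (le_trans (variance_le_mean_sqr lebesgue_measure I f phi (phi m)
  mI hfm (mcont _ cphi) hf0 hf1 hvar)).
have mh : measurable_fun I (fun x => (phi x - phi m) ^+ 2 * f x).
  apply: measurable_funM => //; apply: measurable_funX; apply: measurable_funB => //.
  exact: mcont.
have mk : measurable_fun I (fun x => P x / derive1 Q x * derive1 phi x ^+ 2 * f x).
  apply: measurable_funM => //; apply: mcont => x Ix.
  apply: cvgM; first apply: cvgM.
  - exact: cP.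
  - by apply: cvgV; [exact/lt0r_neq0/hQ'|exact: cQ'].
  - by under eq_cvg do rewrite expr2; rewrite expr2; apply: cvgM; exact: cphi'.
have h0 x : I x -> 0 <= (phi x - phi m) ^+ 2 * f x.
  by move=> Ix; rewrite mulr_ge0 ?sqr_ge0 ?hf0.
have k0 x : I x -> 0 <= P x / derive1 Q x * derive1 phi x ^+ 2 * f x.
  move=> Ix; rewrite mulr_ge0 ?hf0// mulr_ge0 ?sqr_ge0// divr_ge0 ?hP0//.
  exact/ltW/hQ'.
(* Restricting the left integral to [S] loses nothing: [f] vanishes on the rest of [I], which does
   not contain [m]. *)
apply: (@le_trans _ _ (\int[lebesgue_measure]_(x in S)
    ((phi x - phi m) ^+ 2 * f x)%:E)%E).
  rewrite -[X in (\int[_]_(x in X) _ <= _)%E](setDUK SI) ge0_integral_setU//=; last 4 first.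
  - exact: measurableD.
  - by rewrite setDUK//; exact/measurable_EFinP.
  - by move=> x ISx; rewrite lee_fin h0//; case: ISx => [/SI|[]].
  - by apply/disj_setPS => x [Sx [_]].
  rewrite [X in (_ + X)%E]integral0_eq ?adde0// => x [Ix nSx].
  have xm : x != m by apply: contra_notN nSx => /eqP ->.
  by rewrite f_eq0// mulr0.
apply: (@le_trans _ _ (\int[lebesgue_measure]_(x in S)
    (P x / derive1 Q x * derive1 phi x ^+ 2 * f x)%:E)%E); last first.
  by apply: ge0_subset_integral => //; exact/measurable_EFinP.
apply: (le_integral_open_interval S m) => //.
- exact: measurable_funS mh.
- exact: measurable_funS mk.
- by move=> x /SI; exact: h0.
- by move=> x /SI; exact: k0.
move=> x y Sx Sy /andP[xm my].
(* In the degenerate case [x = m = y] both integrals are over a single point. *)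
have [xy|yx] := ltP x y; last first.
  have <- : x = y by apply/le_anti; rewrite yx andbT (le_trans xm my).
  by rewrite set_itv1 !integral_set1.
have xyS : `[x, y]%classic `<=` S by move=> z /=; rewrite in_itv/=; exact: iS.
have xyI := subset_trans xyS SI.
have -> : (\int[lebesgue_measure]_(t in `[x, y])
      (P t / derive1 Q t * derive1 phi t ^+ 2 * f t)%:E =
    \int[lebesgue_measure]_(t in `[x, y])
      (g t * (derive1 phi t ^+ 2 / derive1 Q t))%:E)%E.
  by apply: eq_integral => z _; rewrite /g/=; congr EFin; ring.
apply: (weighted_poincare_itv x y m f g phi Q r) => //.
- by move=> z zxy; split; [apply/hQ'/xyI|apply/g0/xyI|apply/fc/xyS].
- by move=> z /xyI Iz; split; [exact: cphi|exact: cphi'|exact: cQ'].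
- by move=> z /xyI; exact: dg.
- by move=> z /xyI; exact: hr.
(* The end points enclose [m], which gives [Q x <= 0 <= Q y]. *)
have [Ix Iy] := (SI _ Sx, SI _ Sy).
apply/andP; split.
  by move: xm; rewrite le_eqVlt => /predU1P[->|/(Qneg _ Ix)/ltW//]; rewrite Qm.
by move: my; rewrite le_eqVlt => /predU1P[<-|/(Qpos _ Iy)/ltW//]; rewrite Qm.
Unshelve. all: by end_near.
Qed.
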